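(* Let $f\in\mathcal{S}^{1,1}_{\mu,L}(\mathbb{R}^n)$ and $g\in\Gamma_0(\mathbb{R}^n)$, and set $\varphi:=f+g$. Let $x\in\mathbb{R}^n$ and, for $t>0$, let $x^+:=\mathbf{prox}_{tg}(x-t\nabla f(x))=x-t\,\mathcal{G}(x,t)$. Then $$\varphi(x)\geq\varphi(x^+)+\frac{t}{2}\|\mathcal{G}(x,t)\|^2+\frac{t}{2(1-\mu t)}\|\mathcal{G}(x^+,t)\|^2,\qquad 0<t\leq\frac1L.$$ In particular: (i) if $f\in\mathcal{F}^{1,1}_{L}(\mathbb{R}^n)$ and $g\in\Gamma_0(\mathbb{R}^n)$, then $$\varphi(x)\geq\varphi(x^+)+\frac{t}{2}\|\mathcal{G}(x,t)\|^2+\frac{t}{2}\|\mathcal{G}(x^+,t)\|^2,\qquad 0<t\leq\frac1L;$$ (ii) if $f\in\mathcal{F}^{1,1}_{L}(\mathbb{R}^n)$ and $g\equiv0$ (so that $x^+=x-t\nabla f(x)$), then $$f(x)\geq f(x^+)+\frac{t}{2}\|\nabla f(x)\|^2+\frac{t}{2}\|\nabla f(x^+)\|^2,\qquad 0<t\leq\frac1L.$$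
   Context: Constants $L>0$ and $\mu\geq 0$. $\mathcal{S}^{1,1}_{\mu,L}(\mathbb{R}^n)$ is the class of differentiable functions $f:\mathbb{R}^n\to\mathbb{R}$ that are $L$-smooth and $\mu$-strongly convex, i.e. for all $x,y\in\mathbb{R}^n$: $f(y)\leq f(x)+\langle\nabla f(x),y-x\rangle+\frac{L}{2}\|y-x\|^2$ and $f(y)\geq f(x)+\langle\nabla f(x),y-x\rangle+\frac{\mu}{2}\|y-x\|^2$. $\mathcal{F}^{1,1}_L(\mathbb{R}^n):=\mathcal{S}^{1,1}_{0,L}(\mathbb{R}^n)$ is the class of $L$-smooth convex functions. $\Gamma_0(\mathbb{R}^n)$ is the class of proper closed convex functions $\mathbb{R}^n\to(-\infty,+\infty]$. The norm is the one induced by the inner product $\langle\cdot,\cdot\rangle$. The proximal mapping is $\mathbf{prox}_{tg}(x):=\arg\min_{y\in\mathbb{R}^n}\{g(y)+\frac{1}{2t}\|y-x\|^2\}$, and the proximal gradient mapping is $\mathcal{G}(x,t):=t^{-1}\left(x-\mathbf{prox}_{tg}(x-t\nabla f(x))\right)$ for $t>0$. *)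

(* Defs.v *)
From HB Require Import structures.
From mathcomp Require Import all_boot all_order all_algebra.
From mathcomp Require Import all_classical all_reals all_analysis.

Set Implicit Arguments.
Unset Strict Implicit.
Unset Printing Implicit Defensive.

Import Order.TTheory GRing.Theory Num.Theory.
Import numFieldNormedType.Exports.

Local Open Scope classical_set_scope.
Local Open Scope ring_scope.

Section ProximalGradient.
Context {R : realType} {n : nat}.
Implicit Types (x y u v : 'rV[R]_n) (f : 'rV[R]_n -> R) (g : 'rV[R]_n -> \bar R).

Definition dotp u v : R := \sum_(i < n) u 0 i * v 0 i.

(* The Euclidean norm. The library's norm [`|u|] on row vectors is the max
   norm; it is used below only through the topology and the notion of
   differentiability, which do not depend on the choice of norm on R^n. *)
Definition enorm u : R := Num.sqrt (dotp u u).

Definition grad f x : 'rV[R]_n := \row_(i < n) 'D_(delta_mx 0 i) f x.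

(* The class S^{1,1}_{mu,L}(R^n). *)
Definition smooth_strongly_convex (mu L : R) f : Prop :=
  [/\ forall x, differentiable f x,
      forall x y,
        f y <= f x + dotp (grad f x) (y - x) + L / 2 * enorm (y - x) ^+ 2
    & forall x y,
        f y >= f x + dotp (grad f x) (y - x) + mu / 2 * enorm (y - x) ^+ 2].

(* The class F^{1,1}_L(R^n). *)
Definition smooth_convex (L : R) f : Prop := smooth_strongly_convex 0 L f.

Definition proper_fun g : Prop :=
  (forall x, g x != -oo%E) /\ (exists x, g x != +oo%E).

Definition epigraph g : set ('rV[R]_n * R) := [set p | (g p.1 <= p.2%:E)%E].

(* Only used together with [proper_fun], so that the right-hand side is never
   of the form oo - oo; at the endpoints of [0, 1], 0 * +oo = 0. *)
Definition econvex_fun g : Prop :=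
  forall (a : R) x y, 0 <= a <= 1 ->
    (g (a *: x + (1 - a) *: y)%R <= a%:E * g x + (1 - a)%:E * g y)%E.

(* The class Gamma_0(R^n). *)
Definition Gamma0 g : Prop :=
  [/\ proper_fun g, closed (epigraph g) & econvex_fun g].

Definition argmin (h : 'rV[R]_n -> \bar R) : set 'rV[R]_n :=
  [set y | forall z, (h y <= h z)%E].

(* For g in Gamma_0 and t > 0 the argmin is a singleton, and [get] returns its
   unique element. *)
Definition prox (t : R) g x : 'rV[R]_n :=
  get (argmin (fun y => (g y + ((2 * t)^-1 * enorm (y - x) ^+ 2)%:E)%E)).

Definition prox_grad_step f g x (t : R) : 'rV[R]_n :=
  prox t g (x - t *: grad f x).

Definition prox_grad_map f g x (t : R) : 'rV[R]_n :=
  t^-1 *: (x - prox_grad_step f g x t).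

Definition composite f g x : \bar R := ((f x)%:E + g x)%E.

End ProximalGradient.

(* Main.v *)
Require Import Defs.
From HB Require Import structures.
From mathcomp Require Import all_boot all_order all_algebra.
From mathcomp Require Import all_classical all_reals all_analysis.
From mathcomp Require Import ring lra.
Import Order.TTheory GRing.Theory Num.Theory.
Import numFieldNormedType.Exports.
Local Open Scope ring_scope.

(** The upper bound on [f] at [x] and the lower bound at [x^+], both evaluated
at an auxiliary point [x^+ + w], combine with the subgradient
[G(x) - grad f x] of [g] at [x^+] into
[phi x - phi x^+ >= t/2 |G(x)|^2 + <E, w> - (1 - mu t)/(2t) |w|^2],
where [E = G(x) - grad f x + grad f x^+]. Optimising over [w] leaves
[t/(2(1 - mu t)) |E|^2], and [|G(x^+)| <= |E|] because [prox] is nonexpansive.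
The minimiser defining [prox] exists by compactness: by convexity, [g] decreases
at most linearly away from a point of its domain, so the quadratic term wins. *)

(** * Euclidean inner product on row vectors and its comparison with the max norm *)

Section EuclideanSpace.
Local Open Scope classical_set_scope.
Context {R : realType} {n : nat}.
Implicit Types u v w : 'rV[R]_n.

Lemma dotpC u v : dotp u v = dotp v u.
Proof. by apply: eq_bigr => i _; rewrite mulrC. Qed.

Lemma dotpDl u v w : dotp (u + v) w = dotp u w + dotp v w.
Proof. by rewrite -big_split; apply: eq_bigr => i _; rewrite mxE mulrDl. Qed.

Lemma dotpZl (a : R) u v : dotp (a *: u) v = a * dotp u v.
Proof. by rewrite mulr_sumr; apply: eq_bigr => i _; rewrite mxE mulrA. Qed.

Lemma dotpNl u v : dotp (- u) v = - dotp u v.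
Proof. by rewrite -scaleN1r dotpZl mulN1r. Qed.

Lemma dotpDr u v w : dotp u (v + w) = dotp u v + dotp u w.
Proof. by rewrite dotpC dotpDl !(dotpC u). Qed.

Lemma dotpZr (a : R) u v : dotp u (a *: v) = a * dotp u v.
Proof. by rewrite dotpC dotpZl dotpC. Qed.

Lemma dotpNr u v : dotp u (- v) = - dotp u v.
Proof. by rewrite dotpC dotpNl dotpC. Qed.

Definition dotpE := (dotpDl, dotpDr, dotpNl, dotpNr, dotpZl, dotpZr).

Lemma dotp_ge0 u : 0 <= dotp u u.
Proof. by apply: sumr_ge0 => i _; rewrite -expr2 sqr_ge0. Qed.

Lemma enorm_sqr u : enorm u ^+ 2 = dotp u u.
Proof. by rewrite sqr_sqrtr // dotp_ge0. Qed.

Lemma dotp_eq0 u : dotp u u = 0 -> u = 0.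
Proof.
move=> /eqP; rewrite psumr_eq0 => [/allP u0|i _]; last by rewrite -expr2 sqr_ge0.
apply/rowP => i; rewrite mxE; apply/eqP.
by have := u0 i (mem_index_enum i); rewrite mulf_eq0 orbb.
Qed.

(** The entry attaining the max norm contributes its square to the sum. This carries quadratic
    growth over to the max norm, in which the balls below are taken. *)
Lemma sqr_norm_le_dotp u : `|u| ^+ 2 <= dotp u u.
Proof.
have [->|] := eqVneq (`|u|) 0; first by rewrite expr0n dotp_ge0.
move=> /mx_norm_neq0[[i j] /= uE].
rewrite [`|u|]uE (ord1 i) -normrX ger0_norm ?sqr_ge0// expr2.
rewrite /dotp (bigD1 j)//= lerDl sumr_ge0// => k _.
by rewrite -expr2 sqr_ge0.
Qed.

Lemma continuous_dotp_sub w : continuous (fun u => dotp (u - w) (u - w)).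
Proof.
apply: continuous_big => [|i _]; first exact: add_continuous.
have c : continuous (fun v : 'rV[R]_n => v 0 i - w 0 i).
  by move=> v; apply: continuousB; [exact: coord_continuous | exact: cst_continuous].
have -> : (fun v : 'rV[R]_n => (v - w) 0 i * (v - w) 0 i) =
    (fun v => (v 0 i - w 0 i) * (v 0 i - w 0 i)).
  by apply/funext => v; rewrite !mxE.
by move=> u; exact: (cvgM (c u) (c u)).
Qed.

End EuclideanSpace.

(** The sublevel sets at levels above the infimum generate a proper filter on [K]; a cluster point
    lies in each of them by closedness, so it attains the infimum. *)
Lemma compact_min {R : realType} {T : topologicalType} (K : set T)
    (h : T -> \bar R) :
  compact K -> (K !=set0)%classic ->
  (forall a : R, closed [set y | (h y <= a%:E)%E]%classic) ->
  exists2 p, K p & forall y, K y -> (h p <= h y)%E.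
Proof.
move=> cK [p0 Kp0] clh.
pose s := ereal_inf (h @` K)%classic.
have hs y : K y -> (s <= h y)%E by move=> Ky; apply: ereal_inf_lbound; exists y.
have [sy|sy] := eqVneq s +oo%E.
  exists p0 => // y Ky.
  by have := hs _ Ky; rewrite sy leye_eq => /eqP ->; rewrite leey.
have [r sr] : exists r : R, (s < r%:E)%E.
  case: (s) sy => [r _|//|_]; last by exists 0; exact: ltNyr.
  by exists (r + 1); rewrite lte_fin; lra.
pose B (a : R) := (K `&` [set y | (h y <= a%:E)%E])%classic.
pose D := [set a : R | (s < a%:E)%E]%classic.
pose F := filter_from D B.
have FF : ProperFilter F.
  apply: filter_from_proper; last first.
    by move=> a /ereal_inf_lt[_ [y Ky <-]] ya; exists y; split => //; exact: ltW.
  apply: filter_from_filter => [|a b Da Db]; first by exists r.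
  exists (Num.min a b); first by rewrite /D /= /Num.min; case: ifP.
  move=> y [Ky /= yab]; split; split=> //=; apply: le_trans yab _;
    by rewrite lee_fin ge_min lexx ?orbT.
have [p [Kp clp]] : (K `&` cluster F !=set0)%classic.
  by apply: cK; exists r => // y [].
exists p => // y Ky; apply: le_trans (hs _ Ky).
have hp (a : R) : (s < a%:E)%E -> (h p <= a%:E)%E.
  move=> sa; apply: (clh a); move: clp; rewrite clusterE => /(_ (B a)).
  move=> /(_ (ex_intro2 _ _ a sa (@subset_refl _ _))).
  by apply: closureS => z [].
case: (s) sy hp => [q _ hp|//|_ hp].
  apply/lee_addgt0Pr => e e0; rewrite -EFinD; apply: hp.
  by rewrite lte_fin; lra.
rewrite leeNy_eq; case: (h p) hp => [q hp|hp|//].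
  by have := hp (q - 1) (ltNyr _); rewrite lee_fin; lra.
by have := hp 0 (ltNyr _).
Qed.

(** * Existence, optimality condition and nonexpansiveness of the proximal mapping *)

Section ProximalMapping.
Local Open Scope classical_set_scope.
Context {R : realType} {n : nat}.
Implicit Types (x y z p : 'rV[R]_n) (g : 'rV[R]_n -> \bar R).

Lemma compact_closed_ball_norm x (r : R) : compact [set y | `|x - y| <= r].
Proof.
apply: bounded_closed_compact; last exact: closed_closed_ball_.
exists (`|x| + r); split; first by rewrite num_real.
move=> M rM y /= yr; apply: le_trans (ltW rM).
have -> : y = x - (x - y) by rewrite opprB addrC subrK.
by apply: le_trans (ler_normB _ _) _; rewrite lerD2l.
Qed.

(** The set is the preimage of the epigraph under the continuous map [y |-> (y, a - q y)]. *)
Lemma closed_sublevel_add g (q : 'rV[R]_n -> R) (a : R) :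
  closed (epigraph g) -> continuous q ->
  closed [set y | (g y + (q y)%:E <= a%:E)%E].
Proof.
move=> clg cq.
have -> : [set y | (g y + (q y)%:E <= a%:E)%E] =
    (fun y => (y, a - q y)) @^-1` epigraph g.
  by apply/seteqP; split => y; rewrite /epigraph/= EFinB leeBrDr.
have cB : continuous (fun y => a - q y).
  by move=> y; apply: continuousB; [exact: cst_continuous | exact: cq].
by apply: preimage_closed clg => y _; exact: cvg_pair cvg_id (cB y).
Qed.

(** The convexity inequality at the point with weight [r^-1] on [y], multiplied by [r] and solved
    for [g y]. With [r] the distance to [x], that point lies on the unit sphere around [x]. *)
Lemma convex_segment g x y (g0 m r : R) :
  econvex_fun g -> g x = g0%:E -> 1 <= r ->
  (m%:E <= g (r^-1 *: y + (1 - r^-1) *: x)%R)%E ->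
  ((g0 - (g0 - m) * r)%R%:E <= g y)%E.
Proof.
move=> cg gx r1 mg.
have r0 : 0 < r by lra.
have rV : 0 <= r^-1 <= 1 by rewrite invr_ge0 ltW//= invf_le1.
have := le_trans mg (cg _ y x rV); rewrite gx.
case: (g y) => [b||]; last 2 first.
- by rewrite leey.
- by rewrite gt0_muleNy ?lte_fin ?invr_gt0.
rewrite -!EFinM -EFinD !lee_fin => h.
have : r * m <= r * (r^-1 * b + (1 - r^-1) * g0) by rewrite ler_pM2l.
rewrite mulrDr !mulrA mulfV ?gt_eqF// mulrBr mulfV ?gt_eqF//; nra.
Qed.

Lemma Gamma0_prox_exists g z (c : R) : Gamma0 g -> 0 < c ->
  exists p, argmin (fun y => (g y + (c * enorm (y - z)%R ^+ 2)%:E)%E) p.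
Proof.
move=> [[gN [x0 gx0]] clg cg] c0.
pose h y := (g y + (c * enorm (y - z)%R ^+ 2)%:E)%E.
have clh (a : R) : closed [set y | (h y <= a%:E)%E].
  have cq : continuous (fun y : 'rV[R]_n => c * dotp (y - z) (y - z)).
    by move=> y; exact: (continuousM (@cst_continuous _ _ c y) (continuous_dotp_sub z y)).
  have := closed_sublevel_add g _ a clg cq.
  by congr closed; apply/seteqP; split => y; rewrite /h/= enorm_sqr.
have [g0 g0E] : exists g0 : R, g x0 = g0%:E.
  by case: (g x0) (gN x0) gx0 => [r||]// _ _; exists r.
have x0ball (r : R) : 0 <= r -> `|x0 - x0| <= r by rewrite subrr normr0.
(* The minimum [m] of [g] on the unit ball around [x0] fixes the slope [g0 - m] of the linear lower
   bound. *)
have [p1 _ p1min] : exists2 p, `|x0 - p| <= 1 &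
    forall y, `|x0 - y| <= 1 -> (g p <= g y)%E.
  apply: (compact_min _ g (compact_closed_ball_norm x0 1)).
    by exists x0; exact: x0ball.
  move=> a; have := closed_sublevel_add g (fun=> 0) a clg (@cst_continuous _ _ 0).
  by congr closed; apply/seteqP; split => y /=; rewrite adde0.
have [m mE] : exists m : R, g p1 = m%:E.
  have := p1min _ (x0ball _ ler01); rewrite g0E.
  by case: (g p1) (gN p1) => [r||]// _ _; exists r.
have mg0 : m <= g0 by rewrite -lee_fin -mE -g0E p1min// x0ball.
have growth y : 1 <= `|x0 - y| -> ((g0 - (g0 - m) * `|x0 - y|)%R%:E <= g y)%E.
  move=> r1; apply: (convex_segment _ _ _ _ _ _ cg g0E r1); rewrite -mE; apply: p1min.
  set r := `|x0 - y| in r1 *.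
  have -> : x0 - (r^-1 *: y + (1 - r^-1) *: x0) = r^-1 *: (x0 - y).
    by apply/rowP => i; rewrite !mxE; ring.
  rewrite normrZ -/r ger0_norm ?invr_ge0; last by lra.
  by rewrite mulVf// gt_eqF//; lra.
pose k := `|x0 - z|; pose e := c * enorm (x0 - z) ^+ 2.
have k0 : 0 <= k by rewrite normr_ge0.
have e0 : 0 <= e by rewrite mulr_ge0 ?sqr_ge0// ltW.
(* With this [s], the quadratic [c * (r - k) ^+ 2] dominates [(g0 - m) * r + e] once
   [r >= k + 1 + s]. Outside the ball of that radius the objective is thus at least its value
   [g0 + e] at [x0]. *)
pose s := ((g0 - m) * (1 + k) + e) / c.
have s0 : 0 <= s by rewrite divr_ge0 ?(ltW c0)// addr_ge0// mulr_ge0//; lra.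
have sc : s * c = (g0 - m) * (1 + k) + e by rewrite mulfVK// gt_eqF.
have M0 : 0 <= k + (1 + s) by lra.
have [p _ pmin] : exists2 p, `|x0 - p| <= k + (1 + s) &
    forall y, `|x0 - y| <= k + (1 + s) -> (h p <= h y)%E.
  apply: (compact_min _ h (compact_closed_ball_norm x0 _) _ clh).
  by exists x0; exact: x0ball.
exists p => y; have [yM|yM] := leP `|x0 - y| (k + (1 + s)); first exact: pmin.
apply: le_trans (pmin _ (x0ball _ M0)) _.
rewrite /h g0E -/e.
(* The intermediate bound combines [growth] for [g] with the reverse triangle inequality for the
   quadratic term. *)
apply: (@le_trans _ _ ((g0 - (g0 - m) * `|x0 - y| + c * (`|x0 - y| - k) ^+ 2)%:E)).
  rewrite -EFinD lee_fin.
  have [q [-> q0]] : exists q, `|x0 - y| = k + (1 + s) + q /\ 0 <= q.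
    by exists (`|x0 - y| - (k + (1 + s))); split; lra.
  have -> : k + (1 + s) + q - k = 1 + s + q by ring.
  have u0 : 0 <= g0 - m by lra.
  have e1 : (1 + s + q) * (s * c) = (1 + s + q) * ((g0 - m) * (1 + k) + e).
    by rewrite sc.
  have e2 : 0 <= c * ((1 + q) * (1 + s + q)).
    by rewrite !mulr_ge0 ?(ltW c0)//; lra.
  have e3 : 0 <= (s + q) * ((g0 - m) * k + e).
    by apply: mulr_ge0; apply: addr_ge0 => //; exact: mulr_ge0.
  lra.
rewrite EFinD leeD ?growth//; first by lra.
rewrite lee_fin ler_pM2l// enorm_sqr; apply: le_trans (sqr_norm_le_dotp _).
rewrite ler_sqr ?nnegrE//; last by lra.
have := ler_normB (y - z) (x0 - z); rewrite -/k opprB addrA subrK distrC; lra.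
Qed.

Lemma affine_ge0_at0 (a b : R) : 0 <= b ->
  (forall s, 0 < s <= 1 -> 0 <= a + s * b) -> 0 <= a.
Proof.
move=> b0 ab; have [//|a0] := leP 0 a.
have d0 : 0 < b + 1 - a by lra.
(* For [a < 0] this choice of [s] makes [a + s * b] equal to [a * (1 - a) / (b + 1 - a)], which is
   negative. *)
have /ab : 0 < - a / (b + 1 - a) <= 1.
  by rewrite divr_gt0 ?oppr_gt0//= ler_pdivrMr// mul1r; lra.
rewrite -(ler_pM2r d0) mul0r mulrDl mulrAC mulfVK ?gt_eqF//; nra.
Qed.

(** Fermat's rule: compare [p] with [s *: y + (1 - s) *: p], bound [g] there by convexity, divide by
    [s] and let [s] tend to 0. *)
Lemma argmin_subgradient g z p (c : R) :
  proper_fun g -> econvex_fun g -> 0 < c ->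
  argmin (fun y => (g y + (c * enorm (y - z)%R ^+ 2)%:E)%E) p ->
  exists2 gp : R, g p = gp%:E &
    forall y, ((gp + 2 * c * dotp (z - p) (y - p))%R%:E <= g y)%E.
Proof.
move=> [gN [x0 gx0]] cg c0 pmin.
have [gp gpE] : exists gp : R, g p = gp%:E.
  have := pmin x0; case: (g p) (gN p) => [r||]// _; first by exists r.
  by case: (g x0) gx0 (gN x0).
exists gp => // y; have := gN y; case gyE: (g y) => [gy||]// _; last by rewrite leey.
rewrite lee_fin -subr_ge0.
apply: (@affine_ge0_at0 _ (c * dotp (y - p) (y - p))) => [|s /andP[s0 s1]].
  by rewrite mulr_ge0 ?dotp_ge0// ltW.
have s01 : 0 <= s <= 1 by rewrite ltW.
have := le_trans (pmin (s *: y + (1 - s) *: p)) (leeD (cg _ y p s01) (lexx _)).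
rewrite gyE gpE -!EFinM -!EFinD lee_fin !enorm_sqr.
have -> : s *: y + (1 - s) *: p - z = s *: (y - p) - (z - p).
  by apply/rowP => i; rewrite !mxE; ring.
rewrite -(opprB z p); move: (z - p) (y - p) => u d.
rewrite !dotpE (dotpC d u) => H.
rewrite -(pmulr_rge0 _ s0); nra.
Qed.

(** The optimality condition: [t^-1 *: (z - prox t g z)] is a subgradient of [g] at the proximal
    point. All later facts about [prox] rest on it. *)
Lemma proxP g z (t : R) : Gamma0 g -> 0 < t ->
  exists2 gp : R, g (prox t g z) = gp%:E &
    forall y, ((gp + t^-1 * dotp (z - prox t g z) (y - prox t g z))%R%:E <= g y)%E.
Proof.
move=> Gg t0; have c0 : 0 < (2 * t)^-1 by rewrite invr_gt0; lra.
have -> : t^-1 = 2 * (2 * t)^-1 by field; rewrite gt_eqF.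
case: (Gg) => pg _ cg; apply: argmin_subgradient => //.
exact: getPex (Gamma0_prox_exists g z _ Gg c0).
Qed.

(** Adding the two subgradient inequalities gives [<z1 - z2, p1 - p2> >= |p1 - p2|^2]; expanding
    [|(z1 - z2) - (p1 - p2)|^2 >= 0] then concludes. *)
Lemma prox_subgradient_nonexpansive g z1 z2 p1 p2 (g1 g2 t : R) : 0 < t ->
  g p1 = g1%:E -> g p2 = g2%:E ->
  (forall y, ((g1 + t^-1 * dotp (z1 - p1) (y - p1))%R%:E <= g y)%E) ->
  (forall y, ((g2 + t^-1 * dotp (z2 - p2) (y - p2))%R%:E <= g y)%E) ->
  enorm (p1 - p2) <= enorm (z1 - z2).
Proof.
move=> t0 g1E g2E /(_ p2) H1 /(_ p1) H2; rewrite ler_sqrt ?dotp_ge0//.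
move: H1 H2; rewrite g1E g2E !lee_fin => H1 H2.
have {H1 H2} : t^-1 * (dotp (z2 - p2) (p1 - p2) + dotp (z1 - p1) (p2 - p1)) <= 0.
  by lra.
rewrite pmulr_rle0 ?invr_gt0//.
have := dotp_ge0 ((z1 - z2) - (p1 - p2)).
rewrite !dotpE (dotpC p2 p1) (dotpC z2 z1) (dotpC p1 z1) (dotpC p1 z2).
rewrite (dotpC p2 z1) (dotpC p2 z2); lra.
Qed.

Lemma prox_nonexpansive g z1 z2 (t : R) : Gamma0 g -> 0 < t ->
  enorm (prox t g z1 - prox t g z2) <= enorm (z1 - z2).
Proof.
move=> Gg t0.
have [g1 g1E H1] := proxP g z1 t Gg t0; have [g2 g2E H2] := proxP g z2 t Gg t0.
exact: prox_subgradient_nonexpansive t0 g1E g2E H1 H2.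
Qed.

End ProximalMapping.

(** * Descent along a proximal gradient step *)

Section ProximalGradientDescent.
Context {R : realType} {n : nat}.
Implicit Types (x w : 'rV[R]_n) (f : 'rV[R]_n -> R) (g : 'rV[R]_n -> \bar R).

Lemma prox_grad_stepE f g x (t : R) : t != 0 ->
  prox_grad_step f g x t = x - t *: prox_grad_map f g x t.
Proof. by move=> t0; rewrite scalerA divff// scale1r subKr. Qed.

Definition grad_residual f g x (t : R) : 'rV[R]_n :=
  prox_grad_map f g x t - grad f x + grad f (prox_grad_step f g x t).

(** Up to the factor [t], the residual is the difference of the gradient steps from [x] and [x^+],
    whose proximal points are [x^+] and its successor. *)
Lemma prox_grad_map_next_le f g x (t : R) : Gamma0 g -> 0 < t ->
  enorm (prox_grad_map f g (prox_grad_step f g x t) t) ^+ 2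
    <= enorm (grad_residual f g x t) ^+ 2.
Proof.
move=> Gg t0; move pE: (prox_grad_step f g x t) => p.
have -> : grad_residual f g x t =
    t^-1 *: ((x - t *: grad f x) - (p - t *: grad f p)).
  rewrite /grad_residual /prox_grad_map pE; move: (grad f x) (grad f p) => u v.
  by apply/rowP => i; rewrite !mxE; field; rewrite gt_eqF.
have : enorm (p - prox_grad_step f g p t) <=
    enorm (x - t *: grad f x - (p - t *: grad f p)).
  by rewrite -{1}pE; exact: prox_nonexpansive.
rewrite /prox_grad_map; move: (prox_grad_step f g p t) => q.
rewrite -ler_sqr ?nnegrE ?sqrtr_ge0// !enorm_sqr => pq.
by rewrite !(dotpZl t^-1) !(dotpZr t^-1) !ler_pM2l ?invr_gt0.
Qed.

Lemma prox_grad_descent mu L f g x w (t : R) :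
  0 < L -> smooth_strongly_convex mu L f -> Gamma0 g -> 0 < t <= L^-1 ->
  (composite f g (prox_grad_step f g x t)
     + (t / 2 * enorm (prox_grad_map f g x t) ^+ 2
        + dotp (grad_residual f g x t) w
        - (1 - mu * t) / (2 * t) * dotp w w)%R%:E <= composite f g x)%E.
Proof.
move=> L0 [_ fL fmu] Gg /andP[t0 tL].
have Lt : L <= t^-1 by rewrite -(invrK L) lef_pV2 ?posrE ?invr_gt0.
have [gp gpE /(_ x)] := proxP g (x - t *: grad f x) t Gg t0.
rewrite /composite -/(prox_grad_step f g x t) in gpE *.
rewrite gpE; have := Gg => -[[/(_ x) gN _] _ _].
case: (g x) gN => [gx _||//]; last by move=> *; rewrite addey ?leey.
rewrite -!EFinD !lee_fin.
rewrite /grad_residual /prox_grad_map enorm_sqr -/(prox_grad_step f g x t).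
set p := prox_grad_step f g x t.
have := fL x (p + w); have := fmu p (p + w).
rewrite !enorm_sqr; move: (grad f x) (grad f p) => u v.
have -> : p + w - p = w by rewrite addrAC subrr add0r.
have -> : x - t *: u - p = (x - p) - t *: u by rewrite addrAC.
have -> : p + w - x = w - (x - p) by apply/rowP => i; rewrite !mxE; ring.
move: (x - p) => d lb ub.
(* Replaces [L] by [t^-1] in the upper bound on [f] at [p + w]; the cross term of [|w - d|^2] then
   yields the [G(x)] part of the residual. *)
have := ler_wpM2r (dotp_ge0 (w - d)) Lt.
move: ub.
rewrite !dotpE (dotpC d w).
have -> : t^-1 * (dotp d d - t * dotp u d) = t^-1 * dotp d d - dotp u d.
  by rewrite mulrBr mulrA mulVf ?mul1r// gt_eqF.
have -> : t / 2 * (t^-1 * (t^-1 * dotp d d)) = t^-1 * dotp d d / 2.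
  by field; rewrite gt_eqF.
have -> : (1 - mu * t) / (2 * t) * dotp w w = t^-1 * dotp w w / 2 - mu / 2 * dotp w w.
  by field; rewrite gt_eqF.
lra.
Qed.

(* Maximising over [w = s *: E]; when [k <= 0] the lower bound is unbounded
   unless [E = 0]. *)
Lemma residual_bound (C D t k N : R) (E : 'rV[R]_n) : 0 < t -> 0 <= N ->
  N <= enorm E ^+ 2 ->
  (forall w, C + dotp E w - k / (2 * t) * dotp w w <= D) ->
  (C%:E + t%:E / (2 * k)%R%:E * N%:E <= D%:E)%E.
Proof.
move=> t0 N0; rewrite enorm_sqr => NE CD.
have {}CD s : C + s * dotp E E - k / (2 * t) * (s * (s * dotp E E)) <= D.
  by have := CD (s *: E); rewrite !dotpE.
have [k0|k0] := ltP 0 k.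
  rewrite inver gt_eqF ?mulr_gt0// -!EFinM -EFinD lee_fin.
  (* [t / k] maximises the concave quadratic in [s]. *)
  apply: le_trans (CD (t / k)).
  have -> : C + t / k * dotp E E - k / (2 * t) * (t / k * (t / k * dotp E E)) =
      C + t / (2 * k) * dotp E E by field; rewrite !gt_eqF.
  by rewrite lerD2l ler_pM2l// divr_gt0// mulr_gt0.
have EE0 : dotp E E = 0.
  apply/eqP; rewrite eq_le dotp_ge0 andbT leNgt; apply/negP => E0.
  (* At this [s] the linear term equals [|D - C| + 1], and the quadratic term is nonnegative since
     [k <= 0]. *)
  have := CD ((`|D - C| + 1) / dotp E E).
  rewrite mulfVK ?gt_eqF//.
  have : 0 <= - (k / (2 * t) * ((`|D - C| + 1) / dotp E E * (`|D - C| + 1))).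
    rewrite -mulNr -mulNr mulr_ge0//.
      by rewrite divr_ge0 ?oppr_ge0// mulr_ge0// ltW.
    by rewrite mulr_ge0 ?divr_ge0 ?(ltW E0)// addr_ge0.
  by have := ler_norm (D - C); lra.
(* A zero last factor kills the product even when the extended quotient is [+oo]. *)
have -> : N = 0 by apply/eqP; rewrite eq_le N0 andbT -EE0.
by have := CD 0; rewrite mule0 adde0 lee_fin EE0 !mulr0 addr0 subr0.
Qed.

Lemma prox_grad_sufficient_decrease mu L f g x (t : R) :
  0 < L -> smooth_strongly_convex mu L f -> Gamma0 g -> 0 < t <= L^-1 ->
  (composite f g (prox_grad_step f g x t)
     + (t / 2 * enorm (prox_grad_map f g x t) ^+ 2)%R%:E
     + t%:E / (2 * (1 - mu * t))%R%:E
       * (enorm (prox_grad_map f g (prox_grad_step f g x t) t) ^+ 2)%R%:E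
   <= composite f g x)%E.
Proof.
move=> L0 Sf Gg tL; have t0 : 0 < t by case/andP: tL.
have next := prox_grad_map_next_le f g x t Gg t0.
have desc w := prox_grad_descent mu L f g x w t L0 Sf Gg tL.
have [gp gpE _] := proxP g (x - t *: grad f x) t Gg t0.
rewrite /composite in desc *.
have {}gpE : g (prox_grad_step f g x t) = gp%:E by [].
move: (prox_grad_step f g x t) gpE next desc => p gpE next desc.
rewrite gpE in desc *.
have := Gg => -[[/(_ x) gN _] _ _].
case: (g x) gN desc => [gx _ desc||]//; last by move=> *; rewrite addey ?leey.
rewrite -!EFinD.
(* Here [k] is [1 - mu * t]. It can be negative only for [n = 0]: in positive dimension the two
   bounds on [f] force [mu <= L]. *)
apply: (residual_bound _ _ _ _ _ _ t0 _ next) => [|w]; first exact: sqr_ge0.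
by have := desc w; rewrite -!EFinD lee_fin !addrA.
Qed.

Lemma Gamma0_cst0 : Gamma0 (fun _ : 'rV[R]_n => 0 : \bar R)%E.
Proof.
split=> [||a x y _]; last by rewrite !mule0 adde0.
  by split=> //; exists 0.
have -> : epigraph (fun _ : 'rV[R]_n => 0 : \bar R)%E =
    (snd @^-1` [set r : R | 0 <= r])%classic.
  by apply/seteqP; split => -[y r]; rewrite /epigraph/= lee_fin.
by apply: preimage_closed (@closed_ge _ 0) => y _; exact: cvg_snd.
Qed.

(** Testing the subgradient inequality of the zero function at [x] itself gives [|x - p|^2 <= 0]. *)
Lemma prox_cst0 (t : R) x : 0 < t -> prox t (fun=> 0%E) x = x.
Proof.
move=> t0; have [gp [<-] /(_ x)] := proxP (fun=> 0%E) x t Gamma0_cst0 t0.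
rewrite add0r lee_fin pmulr_rle0 ?invr_gt0// => d0.
apply/esym/eqP; rewrite -subr_eq0; apply/eqP/dotp_eq0/eqP.
by rewrite eq_le d0 dotp_ge0.
Qed.

End ProximalGradientDescent.

(* In the first inequality the coefficient t / (2 (1 - mu t)) is a quotient of
   extended reals, so that it is +oo when mu t = 1, and +oo * 0 = 0. *)
Theorem theorem3p2 (R : realType) (n : nat) (L mu : R) (hL : 0 < L) (hmu : 0 <= mu) :
  [/\ (forall (f : 'rV[R]_n -> R) (g : 'rV[R]_n -> \bar R) (x : 'rV[R]_n) (t : R),
         smooth_strongly_convex mu L f -> Gamma0 g -> 0 < t <= L^-1 ->
         let phi := composite f g in
         let G := prox_grad_map f g in
         let xp := prox_grad_step f g x t in
         xp = x - t *: G x t /\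
         (phi x >= phi xp + (t / 2 * enorm (G x t) ^+ 2)%:E
                   + t%:E / (2 * (1 - mu * t))%:E * (enorm (G xp t) ^+ 2)%:E)%E),
      (forall (f : 'rV[R]_n -> R) (g : 'rV[R]_n -> \bar R) (x : 'rV[R]_n) (t : R),
         smooth_convex L f -> Gamma0 g -> 0 < t <= L^-1 ->
         let phi := composite f g in
         let G := prox_grad_map f g in
         let xp := prox_grad_step f g x t in
         (phi x >= phi xp + (t / 2 * enorm (G x t) ^+ 2)%:E
                   + (t / 2 * enorm (G xp t) ^+ 2)%:E)%E)
    & (forall (f : 'rV[R]_n -> R) (x : 'rV[R]_n) (t : R),
         smooth_convex L f -> 0 < t <= L^-1 ->
         let xp := prox_grad_step f (fun=> 0%E) x t in
         xp = x - t *: grad f x /\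
         f x >= f xp + t / 2 * enorm (grad f x) ^+ 2
                + t / 2 * enorm (grad f xp) ^+ 2)].
Proof.
have convex_case (f : 'rV[R]_n -> R) g x t :
    smooth_convex L f -> Gamma0 g -> 0 < t <= L^-1 ->
    (composite f g (prox_grad_step f g x t)
      + (t / 2 * enorm (prox_grad_map f g x t) ^+ 2)%R%:E
      + (t / 2 * enorm (prox_grad_map f g (prox_grad_step f g x t) t) ^+ 2)%R%:E
      <= composite f g x)%E.
  move=> Sf Gg tL.
  have := prox_grad_sufficient_decrease 0 L f g x t hL Sf Gg tL.
  (* For [mu = 0] the denominator is 2, so the extended quotient is the real [t / 2]. *)
  by rewrite mul0r subr0 mulr1 inver pnatr_eq0/= -!EFinM.
split=> [f g x t Sf Gg tL phi G xp|f g x t|f x t Sf tL xp]; last 2 first.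
- exact: convex_case.
- have t0 : 0 < t by case/andP: tL.
  have stepE y : prox_grad_step f (fun=> 0%E) y t = y - t *: grad f y.
    exact: prox_cst0.
  have mapE y : prox_grad_map f (fun=> 0%E) y t = grad f y.
    by rewrite /prox_grad_map stepE opprB addrC subrK scalerA mulVf ?scale1r ?gt_eqF.
  split; first exact: stepE.
  have := convex_case f (fun=> 0%E) x t Sf Gamma0_cst0 tL.
  by rewrite !mapE /composite !adde0 -!EFinD lee_fin.
split; first by apply: prox_grad_stepE; rewrite gt_eqF//; case/andP: tL.
exact: prox_grad_sufficient_decrease hL Sf Gg tL.
Qed.
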